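(* Let $G$ be a locally compact group and let $P\subset G$ be a closed subsemigroup containing the identity such that $G=PP^{-1}$ and the interior $\mathrm{Int}(P)$ of $P$ in $G$ is dense in $P$. Let $X$ be a compact Hausdorff space on which $P$ acts injectively on the right, and assume that the action map $X\times\mathrm{Int}(P)\to X$ is open. Let $\mathcal{G}=X\rtimes P$. Then the canonical cocycle $c:\mathcal{G}\to G$, $c(x,g)=g$, is faithful and closed, i.e. the map $\mathcal{G}\to X\times G\times X$, $\gamma\mapsto(r(\gamma),c(\gamma),s(\gamma))$, is injective and closed. Consequently $\mathcal{G}$ is equivalent (Morita equivalent, as a locally compact groupoid) to the semi-direct product $Y\rtimes G$, where $Y=\mathcal{G}\backslash(X\times G)$ is the Mackey range of $c$. Moreover $\mathcal{G}$ is isomorphic to the reduction $(Y\rtimes G)_{|X'}$, where $X'=\{[x,e]:x\in X\}\subset Y$.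
   Context: All topological spaces are Hausdorff and second countable. A right action of $P$ on $X$ is a continuous map $X\times P\to X$, $(x,a)\mapsto xa$, with $xe=x$ and $(xa)b=x(ab)$; it is injective if $x\mapsto xa$ is injective for every $a\in P$. The semi-direct product groupoid is $$\mathcal{G}=X\rtimes P=\{(x,g)\in X\times G:\ \exists\, a,b\in P,\ y\in X \text{ with } g=ab^{-1},\ xa=yb\},$$ a closed subset of $X\times G$ with the subspace topology. For $(x,g)\in\mathcal{G}$, $s(x,g)$ is the unique $y\in X$ such that $xa=yb$ whenever $g=ab^{-1}$ with $a,b\in P$; $r(x,g)=x$; $(x,g)(y,h)=(x,gh)$ when $y=s(x,g)$; $(x,g)^{-1}=(s(x,g),g^{-1})$. It is a locally compact Hausdorff topological groupoid with unit space $X$. Mackey range: $\mathcal{G}$ acts on the left of $Z=X\times G$ (moment map $(x,a)\mapsto x$) by $\gamma(s(\gamma),a)=(r(\gamma),c(\gamma)a)$, and $G$ acts on the right by $(x,a)b=(x,ab)$. These actions commute; $Y=\mathcal{G}\backslash Z$ is the orbit space with the quotient topology and the induced right $G$-action $[x,a]b=[x,ab]$. When $c$ is faithful and closed the $\mathcal{G}$-action on $Z$ is free and proper and $Y$ is locally compact Hausdorff. For a right $G$-space $Y$, $Y\rtimes G=Y\times G$ is the transformation groupoid with $r(y,g)=y$, $s(y,g)=yg$, $(y,g)(yg,h)=(y,gh)$. For $X'\subset Y$ the reduction is $(Y\rtimes G)_{|X'}=\{(y,g): y\in X',\ yg\in X'\}$. Isomorphism means isomorphism of topological groupoids. An equivalence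 between locally compact groupoids $\mathcal{G}$ and $\mathcal{H}$ (with open range and source maps) is a locally compact space $Z$ which is a left $\mathcal{G}$-space and a right $\mathcal{H}$-space, with free, proper and commuting actions and open surjective moment maps $\rho:Z\to\mathcal{G}^{(0)}$, $\sigma:Z\to\mathcal{H}^{(0)}$ inducing homeomorphisms $Z/\mathcal{H}\simeq\mathcal{G}^{(0)}$ and $\mathcal{G}\backslash Z\simeq\mathcal{H}^{(0)}$. *)

(* Defs.v *)
From HB Require Import structures.
From mathcomp Require Import all_boot.
From mathcomp Require Import all_classical.
From mathcomp Require Import topology.

Set Implicit Arguments.
Unset Strict Implicit.
Unset Printing Implicit Defensive.

Local Open Scope group_scope.
Local Open Scope classical_set_scope.
Local Open Scope quotient_scope.

HB.mixin Record isTopologicalGroup G & Topological G & Group G := {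
  mulg_continuous : continuous (fun p : G * G => p.1 * p.2);
  invg_continuous : continuous (fun a : G => a^-1)
}.

#[short(type="topologicalGroupType")]
HB.structure Definition TopologicalGroup :=
  {G of Topological G & Group G & isTopologicalGroup G}.

(* All spaces are Hausdorff and second countable, by convention. *)
Definition lch_second_countable (T : topologicalType) : Prop :=
  [/\ locally_compact [set: T], hausdorff_space T & @second_countable T].

Definition open_map (S T : topologicalType) (f : S -> T) : Prop :=
  forall U : set S, open U -> open (f @` U).

Definition closed_map (S T : topologicalType) (f : S -> T) : Prop :=
  forall C : set S, closed C -> closed (f @` C).

(* Only used between locally compact Hausdorff spaces, where it agrees, for
   continuous [f], with the other usual definitions of properness. *)
Definition proper_map (S T : topologicalType) (f : S -> T) : Prop :=
  forall K : set T, compact K -> compact (f @^-1` K).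

Definition homeomorphism (S T : topologicalType) (f : S -> T) : Prop :=
  continuous f /\ exists g : T -> S, [/\ continuous g, cancel f g & cancel g f].

Record equivalence_relation (T : Type) (R : T -> T -> Prop) : Prop := {
  eqv_refl : forall x, R x x;
  eqv_sym : forall x y, R x y -> R y x;
  eqv_trans : forall y x z, R x y -> R y z -> R x z
}.

Section Quotient.
Context (T : topologicalType) (R : T -> T -> Prop).
Context (hR : equivalence_relation R).

Let r : rel T := fun x y => `[< R x y >].

Let r_refl : reflexive r.
Proof. by move=> x; apply/asboolP; apply: eqv_refl hR x. Qed.

Let r_sym : symmetric r.
Proof. by move=> x y; apply: asbool_equiv_eq; split; apply: eqv_sym hR _ _. Qed.

Let r_trans : transitive r.
Proof.
move=> y x z /asboolP xy /asboolP yz; apply/asboolP.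
exact: eqv_trans hR _ _ _ xy yz.
Qed.

Definition quotient_rel : equiv_rel T := EquivRel r r_refl r_sym r_trans.

Definition quotient_space : topologicalType :=
  quotient_topology {eq_quot quotient_rel}.

Definition quotient_class (x : T) : quotient_space :=
  \pi_(quotient_space) x.

Definition quotient_repr (q : quotient_space) : T := repr q.

Lemma quotient_reprK (q : quotient_space) :
  quotient_class (quotient_repr q) = q.
Proof. exact: reprK. Qed.

Lemma quotient_classP (x y : T) : quotient_class x = quotient_class y <-> R x y.
Proof.
by split=> [/eqmodP/asboolP//|xy]; apply/eqmodP/asboolP.
Qed.

End Quotient.

(* The product [comp g h] is defined on composable pairs, [src g = rng h].
   The unit space is kept as a separate type, embedded by [idn]. *)
Record groupoid := Groupoid {
  arrow : topologicalType;
  unit_space : topologicalType;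
  rng : arrow -> unit_space;
  src : arrow -> unit_space;
  idn : unit_space -> arrow;
  inv : arrow -> arrow;
  comp : forall g h : arrow, src g = rng h -> arrow;
  rng_idn : forall x, rng (idn x) = x;
  src_idn : forall x, src (idn x) = x;
  rng_inv : forall g, rng (inv g) = src g;
  src_inv : forall g, src (inv g) = rng g;
  rng_comp : forall g h (e : src g = rng h), rng (comp e) = rng g;
  src_comp : forall g h (e : src g = rng h), src (comp e) = src h;
  comp_assoc : forall g h k (e1 : src g = rng h) (e2 : src h = rng k)
    (e3 : src (comp e1) = rng k) (e4 : src g = rng (comp e2)),
    comp e3 = comp e4;
  comp_idl : forall g (e : src (idn (rng g)) = rng g), comp e = g;
  comp_idr : forall g (e : src g = rng (idn (src g))), comp e = g;
  comp_invr : forall g (e : src g = rng (inv g)), comp e = idn (rng g);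
  comp_invl : forall g (e : src (inv g) = rng g), comp e = idn (src g)
}.

Arguments comp {g0} g h e : rename.

Definition composable (GG : groupoid) : set (arrow GG * arrow GG) :=
  [set p | src p.1 = rng p.2].

Arguments composable : clear implicits.

Record topological_groupoid (GG : groupoid) : Prop := {
  rng_continuous : continuous (@rng GG);
  src_continuous : continuous (@src GG);
  idn_continuous : continuous (@idn GG);
  inv_continuous : continuous (@inv GG);
  comp_continuous : continuous (fun p : composable GG =>
    comp (val p).1 (val p).2 (set_mem (valP p)))
}.

Record locally_compact_groupoid (GG : groupoid) : Prop := {
  lcg_topological : topological_groupoid GG;
  lcg_arrow : lch_second_countable (arrow GG);
  lcg_unit : lch_second_countable (unit_space GG);
  lcg_rng_open : open_map (@rng GG);
  lcg_src_open : open_map (@src GG)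
}.

Definition groupoid_isomorphic (GG HH : groupoid) : Prop :=
  exists (phi : arrow GG -> arrow HH) (phi0 : unit_space GG -> unit_space HH),
  [/\ homeomorphism phi,
      homeomorphism phi0,
      forall g, rng (phi g) = phi0 (rng g),
      forall g, src (phi g) = phi0 (src g) &
      forall g h (e : src g = rng h) (e' : src (phi g) = rng (phi h)),
        phi (comp g h e) = comp (phi g) (phi h) e'].

Section Reduction.
Context (GG : groupoid) (A : set (unit_space GG)).

Definition reduction_arrows : set (arrow GG) :=
  [set g | A (rng g) /\ A (src g)].

Local Notation arr := (set_type reduction_arrows).

Definition red_rng (g : arr) : A :=
  exist _ (rng (val g)) (mem_set (proj1 (set_mem (valP g)))).

Definition red_src (g : arr) : A :=
  exist _ (src (val g)) (mem_set (proj2 (set_mem (valP g)))).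

Lemma red_idn_subproof (x : A) : idn (val x) \in reduction_arrows.
Proof.
by apply/mem_set; split; rewrite ?rng_idn ?src_idn; apply: set_mem (valP x).
Qed.

Definition red_idn (x : A) : arr := exist _ (idn (val x)) (red_idn_subproof x).

Lemma red_inv_subproof (g : arr) : inv (val g) \in reduction_arrows.
Proof.
by apply/mem_set; split; rewrite ?rng_inv ?src_inv;
  case: (set_mem (valP g)).
Qed.

Definition red_inv (g : arr) : arr :=
  exist _ (inv (val g)) (red_inv_subproof g).

Lemma red_src_rng (g h : arr) :
  red_src g = red_rng h -> src (val g) = rng (val h).
Proof. by move=> /(congr1 val). Qed.

Lemma red_comp_subproof (g h : arr) (e : red_src g = red_rng h) :
  comp (val g) (val h) (red_src_rng e) \in reduction_arrows.
Proof.
apply/mem_set; split; rewrite ?rng_comp ?src_comp.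
- by case: (set_mem (valP g)).
- by case: (set_mem (valP h)).
Qed.

Definition red_comp (g h : arr) (e : red_src g = red_rng h) : arr :=
  exist _ (comp (val g) (val h) (red_src_rng e)) (red_comp_subproof e).

Program Definition reduction : groupoid :=
  @Groupoid arr A red_rng red_src red_idn red_inv red_comp
    _ _ _ _ _ _ _ _ _ _ _.
Next Obligation. by move=> x; apply: val_inj; apply: rng_idn. Qed.
Next Obligation. by move=> x; apply: val_inj; apply: src_idn. Qed.
Next Obligation. by move=> g; apply: val_inj; apply: rng_inv. Qed.
Next Obligation. by move=> g; apply: val_inj; apply: src_inv. Qed.
Next Obligation. by move=> g h e; apply: val_inj; apply: rng_comp. Qed.
Next Obligation. by move=> g h e; apply: val_inj; apply: src_comp. Qed.
Next Obligation. by move=> *; apply: val_inj; apply: comp_assoc. Qed.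
Next Obligation. by move=> *; apply: val_inj; apply: comp_idl. Qed.
Next Obligation. by move=> *; apply: val_inj; apply: comp_idr. Qed.
Next Obligation. by move=> *; apply: val_inj; apply: comp_invr. Qed.
Next Obligation. by move=> *; apply: val_inj; apply: comp_invl. Qed.

End Reduction.

Arguments reduction : clear implicits.

Record left_groupoid_action (GG : groupoid) (Z : Type) := LeftGroupoidAction {
  lmoment : Z -> unit_space GG;
  lact : forall (g : arrow GG) (z : Z), src g = lmoment z -> Z;
  lmoment_act : forall g z (e : src g = lmoment z), lmoment (lact e) = rng g;
  lact_idn : forall z (e : src (idn (lmoment z)) = lmoment z), lact e = z;
  lact_comp : forall g h z (e1 : src g = rng h) (e2 : src h = lmoment z)
    (e3 : src (comp g h e1) = lmoment z) (e4 : src g = lmoment (lact e2)),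
    lact e3 = lact e4
}.

Arguments lact {GG Z} l g z e.

Record right_groupoid_action (HH : groupoid) (Z : Type) :=
  RightGroupoidAction {
  rmoment : Z -> unit_space HH;
  ract : forall (z : Z) (h : arrow HH), rmoment z = rng h -> Z;
  rmoment_act : forall z h (e : rmoment z = rng h), rmoment (ract e) = src h;
  ract_idn : forall z (e : rmoment z = rng (idn (rmoment z))), ract e = z;
  ract_comp : forall z h k (e1 : src h = rng k) (e2 : rmoment z = rng h)
    (e3 : rmoment z = rng (comp h k e1)) (e4 : rmoment (ract e2) = rng k),
    ract e3 = ract e4
}.

Arguments ract {HH Z} r z h e.

Section LeftAction.
Context (GG : groupoid) (Z : topologicalType) (L : left_groupoid_action GG Z).

Definition lact_domain : set (arrow GG * Z) :=
  [set p | src p.1 = lmoment L p.2].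

Definition lact_map (p : lact_domain) : Z :=
  lact L (val p).1 (val p).2 (set_mem (valP p)).

Definition lact_continuous : Prop :=
  continuous (lmoment L) /\ continuous lact_map.

Definition lact_free : Prop := forall g z (e : src g = lmoment L z),
  lact L g z e = z -> g = idn (lmoment L z).

Definition lact_proper : Prop :=
  proper_map (fun p : lact_domain => (lact_map p, (val p).2)).

Definition lorbit_rel (z z' : Z) : Prop :=
  exists (g : arrow GG) (e : src g = lmoment L z), lact L g z e = z'.

Lemma lorbit_relP : equivalence_relation lorbit_rel.
Proof.
split.
- by move=> z; exists (idn (lmoment L z)), (src_idn _); apply: lact_idn.
- move=> z z' [g [e <-]].
  have e1 : src (inv g) = rng g := src_inv g.
  have e2 : src (inv g) = lmoment L (lact L g z e) by rewrite lmoment_act.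
  have e3 : src (comp (inv g) g e1) = lmoment L z by rewrite src_comp.
  exists (inv g), e2; rewrite -(lact_comp (e1 := e1) e3 e2).
  have E : comp (inv g) g e1 = idn (lmoment L z) by rewrite comp_invl e.
  by move: e3; rewrite E => e3; apply: lact_idn.
- move=> _ z z'' [g [e <-]] [h [e' <-]].
  have e1 : src h = rng g by rewrite e' lmoment_act.
  have e3 : src (comp h g e1) = lmoment L z by rewrite src_comp.
  by exists (comp h g e1), e3; apply: lact_comp.
Qed.

Definition lorbit_space : topologicalType := quotient_space lorbit_relP.

Definition lorbit (z : Z) : lorbit_space := quotient_class lorbit_relP z.

End LeftAction.

Section RightAction.
Context (HH : groupoid) (Z : topologicalType) (R : right_groupoid_action HH Z).

Definition ract_domain : set (Z * arrow HH) :=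
  [set p | rmoment R p.1 = rng p.2].

Definition ract_map (p : ract_domain) : Z :=
  ract R (val p).1 (val p).2 (set_mem (valP p)).

Definition ract_continuous : Prop :=
  continuous (rmoment R) /\ continuous ract_map.

Definition ract_free : Prop := forall z h (e : rmoment R z = rng h),
  ract R z h e = z -> h = idn (rmoment R z).

Definition ract_proper : Prop :=
  proper_map (fun p : ract_domain => ((val p).1, ract_map p)).

Definition rorbit_rel (z z' : Z) : Prop :=
  exists (h : arrow HH) (e : rmoment R z = rng h), ract R z h e = z'.

Lemma rorbit_relP : equivalence_relation rorbit_rel.
Proof.
split.
- by move=> z; exists (idn (rmoment R z)), (esym (rng_idn _)); apply: ract_idn.
- move=> z z' [h [e <-]].
  have e1 : src h = rng (inv h) := esym (rng_inv h).
  have e2 : rmoment R (ract R z h e) = rng (inv h) by rewrite rmoment_act.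
  have e3 : rmoment R z = rng (comp h (inv h) e1) by rewrite rng_comp.
  exists (inv h), e2; rewrite -(ract_comp (e1 := e1) e3 e2).
  have E : comp h (inv h) e1 = idn (rmoment R z) by rewrite comp_invr e.
  by move: e3; rewrite E => e3; apply: ract_idn.
- move=> _ z z'' [h [e <-]] [k [e' <-]].
  have e1 : src h = rng k by rewrite -e' rmoment_act.
  have e3 : rmoment R z = rng (comp h k e1) by rewrite rng_comp.
  by exists (comp h k e1), e3; apply: ract_comp.
Qed.

Definition rorbit_space : topologicalType := quotient_space rorbit_relP.

Definition rorbit (z : Z) : rorbit_space := quotient_class rorbit_relP z.

End RightAction.

Record actions_commute (GG HH : groupoid) (Z : topologicalType)
    (L : left_groupoid_action GG Z) (R : right_groupoid_action HH Z) : Prop := {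
  rmoment_lact : forall g z (e : src g = lmoment L z),
    rmoment R (lact L g z e) = rmoment R z;
  lmoment_ract : forall z h (e : rmoment R z = rng h),
    lmoment L (ract R z h e) = lmoment L z;
  lact_ract : forall g z h (e1 : src g = lmoment L z)
    (e2 : rmoment R z = rng h) (e3 : rmoment R (lact L g z e1) = rng h)
    (e4 : src g = lmoment L (ract R z h e2)),
    ract R (lact L g z e1) h e3 = lact L g (ract R z h e2) e4
}.

Record equivalence_space (GG HH : groupoid) (Z : topologicalType)
    (L : left_groupoid_action GG Z) (R : right_groupoid_action HH Z) : Prop := {
  eqs_space : lch_second_countable Z;
  eqs_lact_continuous : lact_continuous L;
  eqs_ract_continuous : ract_continuous R;
  eqs_lact_free : lact_free L;
  eqs_ract_free : ract_free R;
  eqs_lact_proper : lact_proper L;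
  eqs_ract_proper : ract_proper R;
  eqs_commute : actions_commute L R;
  eqs_lmoment_open : open_map (lmoment L);
  eqs_lmoment_surj : range (lmoment L) = [set: unit_space GG];
  eqs_rmoment_open : open_map (rmoment R);
  eqs_rmoment_surj : range (rmoment R) = [set: unit_space HH];
  eqs_lmoment_homeo : exists f : rorbit_space R -> unit_space GG,
    homeomorphism f /\ forall z, f (rorbit R z) = lmoment L z;
  eqs_rmoment_homeo : exists f : lorbit_space L -> unit_space HH,
    homeomorphism f /\ forall z, f (lorbit L z) = rmoment R z
}.

Definition groupoid_equivalent (GG HH : groupoid) : Prop :=
  [/\ locally_compact_groupoid GG, locally_compact_groupoid HH &
      exists (Z : topologicalType) (L : left_groupoid_action GG Z)
             (R : right_groupoid_action HH Z), equivalence_space L R].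

Record ore_subsemigroup (G : groupType) (P : set G) : Prop := {
  ore_one : P 1;
  ore_mul : forall a b, P a -> P b -> P (a * b);
  ore_gen : forall g, exists a b, [/\ P a, P b & g = a * b^-1]
}.

(* An action of [P] on [X] is given by [act : X -> G -> X], of which only the
   values [act x a] for [a] in [P] are meaningful. *)
Record right_action (G : groupType) (P : set G) (X : Type)
    (act : X -> G -> X) : Prop := {
  act1 : forall x, act x 1 = x;
  actM : forall x a b, P a -> P b -> act (act x a) b = act x (a * b)
}.

Definition injective_action (G : groupType) (P : set G) (X : Type)
    (act : X -> G -> X) : Prop :=
  forall a, P a -> injective (act^~ a).

Section Transformation.
Context (G : topologicalGroupType) (Y : topologicalType) (act : Y -> G -> Y).
Context (hact : right_action [set: G] act).

Let actM' x a b : act (act x a) b = act x (a * b).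
Proof. exact: (actM hact). Qed.

(* r(y, g) = y, s(y, g) = y g and (y, g) (y g, h) = (y, g h). *)
Program Definition transformation_groupoid : groupoid :=
  @Groupoid (Y * G)%type Y (fun p => p.1) (fun p => act p.1 p.2)
    (fun y => (y, 1)) (fun p => (act p.1 p.2, p.2^-1))
    (fun p q _ => (p.1, p.2 * q.2)) _ _ _ _ _ _ _ _ _ _ _.
Next Obligation. by []. Qed.
Next Obligation. by move=> y /=; apply: act1 hact y. Qed.
Next Obligation. by []. Qed.
Next Obligation. by case=> y g /=; rewrite actM' mulgV (act1 hact). Qed.
Next Obligation. by []. Qed.
Next Obligation. by case=> y g [z h] /= <-; rewrite actM'. Qed.
Next Obligation. by move=> *; rewrite /= mulgA. Qed.
Next Obligation. by case=> y g /= _; rewrite mul1g. Qed.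
Next Obligation. by case=> y g /= _; rewrite mulg1. Qed.
Next Obligation. by case=> y g /= _; rewrite mulgV. Qed.
Next Obligation. by case=> y g /= _; rewrite mulVg. Qed.

End Transformation.

Record cocycle (GG : groupoid) (G : topologicalGroupType)
    (c : arrow GG -> G) : Prop := {
  cocycle_continuous : continuous c;
  cocycleM : forall g h (e : src g = rng h), c (comp g h e) = c g * c h
}.

Definition cocycle_map (GG : groupoid) (G : topologicalGroupType)
    (c : arrow GG -> G) (g : arrow GG) : unit_space GG * G * unit_space GG :=
  (rng g, c g, src g).

Definition faithful_cocycle (GG : groupoid) (G : topologicalGroupType)
    (c : arrow GG -> G) : Prop := injective (cocycle_map c).

Definition closed_cocycle (GG : groupoid) (G : topologicalGroupType)
    (c : arrow GG -> G) : Prop := closed_map (cocycle_map c).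

Section Mackey.
Context (GG : groupoid) (G : topologicalGroupType) (c : arrow GG -> G).
Context (hc : cocycle c).

Lemma cocycle1 (x : unit_space GG) : c (idn x) = 1.
Proof.
have e : src (idn (rng (idn x))) = rng (idn x) := src_idn _.
have := cocycleM hc e; rewrite comp_idl rng_idn => E.
by apply: (mulgI (c (idn x))); rewrite mulg1 -E.
Qed.

Local Notation Z := (unit_space GG * G)%type.

(* g (s(g), a) = (r(g), c(g) a) *)
Program Definition mackey_left_action : left_groupoid_action GG Z :=
  @LeftGroupoidAction GG Z (fun z => z.1) (fun g z _ => (rng g, c g * z.2))
    _ _ _.
Next Obligation. by []. Qed.
Next Obligation. by case=> x a /= _; rewrite cocycle1 mul1g rng_idn. Qed.
Next Obligation.
by move=> g h [x a] e *; rewrite /= rng_comp (cocycleM hc) mulgA.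
Qed.

Definition mackey_range : topologicalType := lorbit_space mackey_left_action.

Definition mackey_class (z : Z) : mackey_range := lorbit mackey_left_action z.

Definition mackey_act (y : mackey_range) (b : G) : mackey_range :=
  let z := quotient_repr y in mackey_class (z.1, z.2 * b).

Lemma mackey_actE (x : unit_space GG) (a b : G) :
  mackey_act (mackey_class (x, a)) b = mackey_class (x, a * b).
Proof.
rewrite /mackey_act; apply/quotient_classP.
have /quotient_classP := quotient_reprK (mackey_class (x, a)).
case: (quotient_repr _) => y d [g [/= e [<- <-]]].
by exists g, e; rewrite /= mulgA.
Qed.

Lemma mackey_actP : right_action [set: G] mackey_act.
Proof.
have ex y : exists x a, y = mackey_class (x, a).
  exists (quotient_repr y).1, (quotient_repr y).2.
  by rewrite -surjective_pairing [RHS]quotient_reprK.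
split=> [y|y a b _ _]; have [x [d ->]] := ex y; rewrite !mackey_actE.
- by rewrite mulg1.
- by rewrite mulgA.
Qed.

Definition mackey_groupoid : groupoid := transformation_groupoid mackey_actP.

Definition mackey_base : set mackey_range :=
  [set mackey_class (x, 1) | x in [set: unit_space GG]].

End Mackey.

Arguments mackey_base {GG G c} hc _.

Section SemiDirect.
Context (G : topologicalGroupType) (P : set G) (X : topologicalType).
Context (act : X -> G -> X).

Definition semidirect_arrows : set (X * G) :=
  [set p | exists a b y,
    [/\ P a, P b, p.2 = a * b^-1 & act p.1 a = act y b]].

Local Notation arr := (set_type semidirect_arrows).

Context (hP : ore_subsemigroup P) (hact : right_action P act).
Context (hinj : injective_action P act).

Lemma ore_common (a b a' b' : G) : P b -> P b' -> a * b^-1 = a' * b'^-1 ->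
  exists p q, [/\ P p, P q, a * p = a' * q & b * p = b' * q].
Proof.
move=> Pb Pb' e.
have [p [q [Pp Pq E]]] := ore_gen hP (b^-1 * b').
have bp : b * p = b' * q.
  by apply: (mulgI b^-1); rewrite mulgA mulVg mul1g mulgA E -mulgA mulVg mulg1.
exists p, q; split=> //.
have -> : a' = a * b^-1 * b' by rewrite e -mulgA mulVg mulg1.
by rewrite -[in RHS]mulgA -bp -mulgA (mulgA b^-1) mulVg mul1g.
Qed.

Lemma semidirect_indep (x y : X) (a b a' b' : G) :
  P a -> P b -> P a' -> P b' -> a * b^-1 = a' * b'^-1 ->
  act x a = act y b -> act x a' = act y b'.
Proof.
move=> Pa Pb Pa' Pb' e xy.
have [p [q [Pp Pq ap bp]]] := ore_common Pb Pb' e.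
apply: (hinj Pq); rewrite !(actM hact)// -ap -bp.
by rewrite -!(actM hact)// xy.
Qed.

Lemma semidirect_src_ex (g : arr) : exists! y,
  forall a b, P a -> P b -> (val g).2 = a * b^-1 -> act (val g).1 a = act y b.
Proof.
have [a [b [y [Pa Pb e xy]]]] := set_mem (valP g).
exists y; split=> [a' b' Pa' Pb' e'|y' /(_ a b Pa Pb e)].
  by apply: semidirect_indep xy => //; rewrite -e -e'.
by rewrite xy => /(hinj Pb).
Qed.

Definition semidirect_rng (g : arr) : X := (val g).1.

Definition semidirect_src (g : arr) : X :=
  projT1 (cid (semidirect_src_ex g)).

Lemma semidirect_srcP (g : arr) (a b : G) : P a -> P b ->
  (val g).2 = a * b^-1 -> act (val g).1 a = act (semidirect_src g) b.
Proof.
by rewrite /semidirect_src; case: cid => y /= [yP _]; apply: yP.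
Qed.

Lemma semidirect_src_eq (g : arr) (y : X) (a b : G) : P a -> P b ->
  (val g).2 = a * b^-1 -> act (val g).1 a = act y b -> semidirect_src g = y.
Proof.
by move=> Pa Pb e xy; apply: (hinj Pb); rewrite -(semidirect_srcP Pa Pb e).
Qed.

Lemma semidirect_idn_subproof (x : X) : (x, 1) \in semidirect_arrows.
Proof.
apply/mem_set; exists 1, 1, x; rewrite /= mulgV.
by split=> //; apply: ore_one hP.
Qed.

Definition semidirect_idn (x : X) : arr :=
  exist _ (x, 1) (semidirect_idn_subproof x).

Lemma semidirect_inv_subproof (g : arr) :
  (semidirect_src g, (val g).2^-1) \in semidirect_arrows.
Proof.
have [a [b [y [Pa Pb e xy]]]] := set_mem (valP g).
apply/mem_set; exists b, a, (val g).1; split=> //=.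
  by rewrite e invgM invgK.
by rewrite (semidirect_srcP Pa Pb e).
Qed.

Definition semidirect_inv (g : arr) : arr :=
  exist _ (semidirect_src g, (val g).2^-1) (semidirect_inv_subproof g).

Lemma semidirect_comp_witness (g h : arr) :
  semidirect_src g = semidirect_rng h ->
  exists a b, [/\ P a, P b, (val g).2 * (val h).2 = a * b^-1 &
    act (val g).1 a = act (semidirect_src h) b].
Proof.
move=> gh.
have [a [b [_ [Pa Pb e _]]]] := set_mem (valP g).
have [k [d [_ [Pk Pd e' _]]]] := set_mem (valP h).
have xy := semidirect_srcP Pa Pb e.
have yz := semidirect_srcP Pk Pd e'.
have [p [q [Pp Pq E]]] := ore_gen hP (b^-1 * k).
have bp : b * p = k * q.
  by apply: (mulgI b^-1); rewrite mulgA mulVg mul1g mulgA E -mulgA mulVg mulg1.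
exists (a * p), (d * q); split; try exact: (ore_mul hP).
  rewrite e e' invgM -!mulgA; congr (_ * _).
  by rewrite (mulgA b^-1) E -!mulgA.
rewrite -!(actM hact)// xy -yz gh !(actM hact)//.
by rewrite bp.
Qed.

Lemma semidirect_comp_subproof (g h : arr) :
  semidirect_src g = semidirect_rng h ->
  ((val g).1, (val g).2 * (val h).2) \in semidirect_arrows.
Proof.
move=> /semidirect_comp_witness[a [b [Pa Pb e xy]]].
by apply/mem_set; exists a, b, (semidirect_src h).
Qed.

Definition semidirect_comp (g h : arr)
    (e : semidirect_src g = semidirect_rng h) : arr :=
  exist _ ((val g).1, (val g).2 * (val h).2) (semidirect_comp_subproof e).

Program Definition semidirect_groupoid : groupoid :=
  @Groupoid arr X semidirect_rng semidirect_src semidirect_idn semidirect_inv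
    semidirect_comp _ _ _ _ _ _ _ _ _ _ _.
Next Obligation. by []. Qed.
Next Obligation.
move=> x; have P1 := ore_one hP.
by apply: (semidirect_src_eq P1 P1) => //=; rewrite mulgV.
Qed.
Next Obligation. by []. Qed.
Next Obligation.
move=> g; have [a [b [_ [Pa Pb e _]]]] := set_mem (valP g).
apply: (semidirect_src_eq Pb Pa) => /=; first by rewrite e invgM invgK.
by rewrite -(semidirect_srcP Pa Pb e).
Qed.
Next Obligation. by []. Qed.
Next Obligation.
move=> g h e; have [a [b [Pa Pb e' xy]]] := semidirect_comp_witness e.
exact: (semidirect_src_eq Pa Pb).
Qed.
Next Obligation. by move=> *; apply: val_inj; rewrite /= mulgA. Qed.
Next Obligation.
by move=> g e; apply: val_inj; rewrite /= mul1g [RHS]surjective_pairing.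
Qed.
Next Obligation.
by move=> g e; apply: val_inj; rewrite /= mulg1 [RHS]surjective_pairing.
Qed.
Next Obligation. by move=> g e; apply: val_inj; rewrite /= mulgV. Qed.
Next Obligation. by move=> g e; apply: val_inj; rewrite /= mulVg. Qed.

Definition canonical_cocycle (g : arrow semidirect_groupoid) : G := (val g).2.

Lemma canonical_cocycleP : cocycle canonical_cocycle.
Proof.
split=> // g.
apply: (@continuous_comp _ _ _ (val : arr -> X * G) snd).
- exact: initial_continuous.
- exact: cvg_snd.
Qed.

End SemiDirect.

Arguments canonical_cocycle {G P X act} hP hact hinj g.

(* Main.v *)
Require Import Defs.
From mathcomp Require Import all_boot.
From mathcomp Require Import all_classical.
From mathcomp Require Import topology.

(* Every g in G can be written g = a b^-1 with a and b interior to P, and then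
   g' = (g' b) b^-1 with g' b in P for all g' near g. So locally the graph
   {(x, g, s(x, g))} is the equalizer of (x, g, y) |-> x (g b) and y b, which
   makes it closed, and s continuous because y |-> y b is an embedding of the
   compact space X; openness of r comes from openness of the action of Int(P).

   For a faithful closed cocycle c, the map (r, c, s) is a closed embedding of
   GG in X x G x X. Two points (x, a) and (y, b) of Z = X x G are in the same
   orbit iff (y, b a^-1, x) is in its closed image, so Y is locally compact
   Hausdorff, and Z itself, with the moment maps Z -> X and Z -> Y, is the
   equivalence between GG and the transformation groupoid of Y.
   When c^-1(e) is reduced to the units and X is compact, x |-> [x, e] embeds
   X in Y, and (r, c, s) identifies GG with the reduction to the image. *)

Set Implicit Arguments.
Unset Strict Implicit.
Unset Printing Implicit Defensive.

Local Open Scope group_scope.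
Local Open Scope classical_set_scope.

(** * Embeddings, open quotients and products *)

Section Topology.
Implicit Types S T U V : topologicalType.

Lemma continuous_pair U S T (f : U -> S) (g : U -> T) :
  continuous f -> continuous g -> continuous (fun u => (f u, g u)).
Proof. by move=> cf cg u; apply: cvg_pair; [exact: cf|exact: cg]. Qed.

Lemma continuous_compT U S T (f : U -> S) (g : S -> T) :
  continuous f -> continuous g -> continuous (g \o f).
Proof. by move=> cf cg u; apply: continuous_comp; [exact: cf|exact: cg]. Qed.

Lemma fst_continuous S T : continuous (@fst S T).
Proof. by move=> p; exact: cvg_fst. Qed.

Lemma snd_continuous S T : continuous (@snd S T).
Proof. by move=> p; exact: cvg_snd. Qed.

Lemma id_continuousT T : continuous (@id T).
Proof. by move=> x; exact: cvg_id. Qed.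

Lemma open_preimage S T (f : S -> T) (A : set T) :
  continuous f -> open A -> open (f @^-1` A).
Proof. by move=> /continuousP; apply. Qed.

Lemma closed_preimage S T (f : S -> T) (A : set T) :
  continuous f -> closed A -> closed (f @^-1` A).
Proof. by move=> /continuous_closedP; apply. Qed.

Lemma nbhs_setX S T (A : set S) (B : set T) (p : S * T) :
  nbhs p.1 A -> nbhs p.2 B -> nbhs p (A `*` B).
Proof. by move=> pA pB; exists (A, B). Qed.

(** The last field makes the topology of [S] the initial one. It is phrased on neighbourhoods
    because continuity and cluster points are tested there. *)
Record embedding S T (f : S -> T) : Prop := {
  embedding_continuous : continuous f;
  embedding_injective : injective f;
  embedding_nbhs : forall x A, nbhs x A ->
    exists2 B, nbhs (f x) B & f @^-1` B `<=` A
}.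

Lemma embedding_id T : embedding (@id T).
Proof. by split=> // [|x A xA]; [exact: id_continuousT|exists A]. Qed.

Lemma embedding_val T (A : set T) : embedding (val : A -> T).
Proof.
split=> [| |x B [_ [[W oW <-] Wx WB]]]; first exact: initial_continuous.
  exact: val_inj.
by exists W => //; exact: open_nbhs_nbhs.
Qed.

Lemma embedding_comp U S T (f : U -> S) (g : S -> T) :
  embedding f -> embedding g -> embedding (g \o f).
Proof.
move=> ef eg; split.
- exact: continuous_compT (embedding_continuous ef) (embedding_continuous eg).
- exact: inj_comp (embedding_injective eg) (embedding_injective ef).
move=> x A /(embedding_nbhs ef)[B /(embedding_nbhs eg)[C xC CB] BA].
by exists C => // y /CB/BA.
Qed.

Lemma embedding_prod S S' T T' (f : S -> T) (f' : S' -> T') :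
  embedding f -> embedding f' ->
  embedding (fun p : S * S' => (f p.1, f' p.2)).
Proof.
move=> ef ef'; split.
- apply: continuous_pair.
    exact: continuous_compT (@fst_continuous _ _) (embedding_continuous ef).
  exact: continuous_compT (@snd_continuous _ _) (embedding_continuous ef').
- by move=> [x x'] [y y'] [/(embedding_injective ef) ->
    /(embedding_injective ef') ->].
move=> [x x'] A [[B B']] /= [/(embedding_nbhs ef)[C xC CB]
  /(embedding_nbhs ef')[C' xC' CB']] BA.
exists (C `*` C'); first exact: nbhs_setX.
by move=> [y y'] /= [/CB By /CB' By']; apply: BA.
Qed.

(** Universal property of the initial topology: continuity into a subspace or an arrow space is
    checked after composing with [val] or [cocycle_map]. *)
Lemma embedding_continuousP U S T (f : S -> T) (h : U -> S) :
  embedding f -> continuous (f \o h) -> continuous h.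
Proof.
move=> ef cfh u A /(embedding_nbhs ef)[B /cfh uB BA].
exact: (@filterS _ (nbhs u) _ ((f \o h) @^-1` B) _ (fun v => BA (h v)) uB).
Qed.

(** A filter on [K] is pushed forward along [f]. A cluster point there has the form [f x], and [x]
    clusters the original filter because each of its neighbourhoods contains the preimage of one of
    [f x]. *)
Lemma embedding_compact S T (f : S -> T) (K : set S) :
  embedding f -> compact (f @` K) -> compact K.
Proof.
move=> ef cK F PF FK.
have FfK : (f @ F) (f @` K)
  by exact: (@filterS _ F _ _ _ (@preimage_image _ _ f K) FK).
have [_ [[x Kx <-] clx]] := cK (f @ F) (fmap_proper_filter f PF) FfK.
exists x; split=> // A B FA /(embedding_nbhs ef)[C xC CB].
have FfA : (f @ F) (f @` A)
  by exact: (@filterS _ F _ _ _ (@preimage_image _ _ f A) FA).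
have [_ [[a Aa <-] Ca]] := clx _ _ FfA xC.
by exists a; split=> //; apply: CB.
Qed.

Lemma embedding_hausdorff S T (f : S -> T) :
  embedding f -> hausdorff_space T -> hausdorff_space S.
Proof.
move=> ef hT x y xy; apply: (embedding_injective ef); apply: hT => A B.
move=> /(embedding_continuous ef) xA /(embedding_continuous ef) yB.
by have [z [Az Bz]] := xy _ _ xA yB; exists (f z).
Qed.

Lemma embedding_second_countable S T (f : S -> T) :
  embedding f -> @second_countable T -> @second_countable S.
Proof.
move=> ef [B cB [oB bB]].
exists [set f @^-1` V | V in B].
  exact: sub_countable (card_image_le _ _) cB.
split=> [_ [V BV <-]|x A /(embedding_nbhs ef)[C xC CA]].
  exact: open_preimage (embedding_continuous ef) (oB _ BV).
have [V [BV Vx] VC] := bB _ _ xC.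
exists (f @^-1` V); first by split=> //; exists V.
by move=> y /VC/CA.
Qed.

(** A compact neighbourhood of [f x] meets the closed range in a compact set, which pulls back to a
    compact set along the embedding. *)
Lemma embedding_locally_compact S T (f : S -> T) :
  embedding f -> closed (range f) -> locally_compact [set: T] ->
  locally_compact [set: S].
Proof.
move=> ef cf lT x _; have [A] := lT (f x) I.
rewrite !withinET => xA [cA clA].
exists (f @^-1` A); first exact: (embedding_continuous ef).
split; last first.
  exact: closed_preimage (embedding_continuous ef) clA.
apply: (embedding_compact ef).
rewrite (_ : f @` _ = A `&` range f); first exact: compact_closedI.
apply/seteqP; split=> [_ [y Ay <-]|_ [/[swap] [[y _ <-]] Ay]].
  by split=> //; exists y.
by exists y.
Qed.

Lemma lch_closed_embedding S T (f : S -> T) :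
  embedding f -> closed (range f) ->
  lch_second_countable T -> lch_second_countable S.
Proof.
move=> ef cf [lT hT sT]; split.
- exact: embedding_locally_compact ef cf lT.
- exact: embedding_hausdorff ef hT.
- exact: embedding_second_countable ef sT.
Qed.

Lemma lch_prod S T : lch_second_countable S -> lch_second_countable T ->
  lch_second_countable (S * T)%type.
Proof.
move=> [lS hS [B cB [oB bB]]] [lT hT [B' cB' [oB' bB']]]; split.
- move=> [x y] _; have [A] := lS x I; have [A'] := lT y I.
  rewrite !withinET => yA' [cA' clA'] xA [cA clA].
  exists (A `*` A'); first exact: nbhs_setX.
  split; first exact: compact_setX.
  rewrite (_ : A `*` A' = (fst @^-1` A) `&` (snd @^-1` A'))//.
  apply: closedI.
    exact: closed_preimage (@fst_continuous S T) clA.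
  exact: closed_preimage (@snd_continuous S T) clA'.
- move=> [x y] [x' y'] xy; congr pair.
    apply: hS => A A' xA xA'.
    have := xy (A `*` setT) (A' `*` setT) (nbhs_setX (p := (x, y)) xA filterT)
      (nbhs_setX (p := (x', y')) xA' filterT).
    by move=> [[z w] [[/= Az _] [/= A'z _]]]; exists z.
  apply: hT => A A' yA yA'.
  have := xy (setT `*` A) (setT `*` A') (nbhs_setX (p := (x, y)) filterT yA)
    (nbhs_setX (p := (x', y')) filterT yA').
  by move=> [[z w] [[/= _ Aw] [/= _ A'w]]]; exists w.
- exists [set p.1 `*` p.2 | p in B `*` B'].
    by apply: sub_countable (card_image_le _ _) _; exact: countableX.
  split=> [_ [[V V'] [/= /oB oV /oB' oV'] <-]|].
    rewrite openE => -[x y] [/= Vx V'y].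
    by apply: nbhs_setX; exact: open_nbhs_nbhs.
  move=> [x y] A [[C C'] /= [/bB[V [BV Vx] VC] /bB'[V' [BV' V'y] V'C]] CA].
  exists (V `*` V'); first by split=> //; exists (V, V').
  by move=> [a b] [/= /VC Ca /V'C C'b]; apply: CA.
Qed.

(** * Open maps and open quotients *)

Lemma open_mapP S T (f : S -> T) :
  open_map f <-> forall x A, nbhs x A -> nbhs (f x) (f @` A).
Proof.
split=> [of_ x A|nf U oU].
  rewrite nbhsE => -[V [oV Vx] VA].
  apply: (filterS (image_subset f VA)); apply: open_nbhs_nbhs.
  by split; [exact: of_|exists x].
rewrite openE => _ [x Ux <-]; apply: nf.
exact: open_nbhs_nbhs.
Qed.

Lemma open_map_comp U S T (f : U -> S) (g : S -> T) :
  open_map f -> open_map g -> open_map (g \o f).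
Proof. by move=> of_ og A /of_/og; rewrite image_comp. Qed.

Lemma open_map_prod S S' T T' (f : S -> T) (f' : S' -> T') :
  open_map f -> open_map f' ->
  open_map (fun p : S * S' => (f p.1, f' p.2)).
Proof.
move=> /open_mapP of_ /open_mapP of'; apply/open_mapP.
move=> [x x'] A [[B B'] /= [/of_ xB /of' xB'] BA].
have := nbhs_setX (p := (f x, f' x')) xB xB'.
apply: filterS => -[_ _] [/= [y By <-] [y' By' <-]].
by exists (y, y') => //; apply: BA.
Qed.

Lemma open_map_id T : open_map (@id T).
Proof. by move=> A; rewrite image_id. Qed.

Lemma homeomorphism_open_map S T (f : S -> T) :
  homeomorphism f -> open_map f.
Proof.
move=> [_ [g [cg fK gK]]] A oA.
rewrite (_ : f @` A = g @^-1` A).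
  exact: open_preimage.
apply/seteqP; split=> [_ [x Ax <-]|y gAy]; first by rewrite /= fK.
by exists (g y) => //; rewrite gK.
Qed.

Lemma fst_open_map S T : open_map (@fst S T).
Proof. exact: fst_open. Qed.

(** The preimage of [A] under [h] is the [q]-image of its preimage under [h \o q]. Openness survives
    products with an identity map, so this also covers maps out of [Y * G]. *)
Lemma open_quotient_continuous U S T (q : S -> T) (h : T -> U) :
  open_map q -> range q = [set: T] -> continuous (h \o q) -> continuous h.
Proof.
move=> oq sq /continuousP chq; apply/continuousP => A /chq/oq.
rewrite (_ : q @` _ = h @^-1` A)//; apply/seteqP; split=> [_ [x Ax <-]//|y Ay].
by have : range q y; [rewrite sq|move=> [x _ xy]; exists x; rewrite //= xy].
Qed.

(** If [q x] and [q x'] cannot be separated, the images of any neighbourhoods of [x] and [x'] meet,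
    so [(x, x')] is a limit of equivalent pairs. *)
Lemma open_quotient_hausdorff S T (q : S -> T) :
  open_map q -> range q = [set: T] ->
  closed [set p : S * S | q p.1 = q p.2] -> hausdorff_space T.
Proof.
move=> /open_mapP oq sq cq y y'.
have : range q y by rewrite sq.
have : range q y' by rewrite sq.
move=> [x' _ <-] [x _ <-] xx'.
apply: (cq (x, x')) => A [[B B'] /= [/oq xB /oq xB'] BA].
have [_ [[z Bz <-] [z' Bz' zz']]] := xx' _ _ xB xB'.
by exists (z, z'); split=> //; apply: BA.
Qed.

Lemma open_quotient_second_countable S T (q : S -> T) :
  continuous q -> open_map q -> range q = [set: T] ->
  @second_countable S -> @second_countable T.
Proof.
move=> cq oq sq [B cB [oB bB]]; exists [set q @` V | V in B].
  exact: sub_countable (card_image_le _ _) cB.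
split=> [_ [V /oB/oq oV <-]//|y A].
have : range q y by rewrite sq.
move=> [x _ <-] /cq /bB[V [BV Vx] VA].
exists (q @` V); first by split; [exists V|exists x].
by move=> _ [z /VA Az <-].
Qed.

(** Images of compact neighbourhoods are compact neighbourhoods, and the Hausdorff property makes
    them closed, as [locally_compact] demands. *)
Lemma open_quotient_lch S T (q : S -> T) :
  continuous q -> open_map q -> range q = [set: T] ->
  closed [set p : S * S | q p.1 = q p.2] ->
  lch_second_countable S -> lch_second_countable T.
Proof.
move=> cq oq sq clq [lS hS sS].
have hT := open_quotient_hausdorff oq sq clq.
split=> //; last exact: open_quotient_second_countable sS.
move=> y _; have : range q y by rewrite sq.
move=> [x _ <-]; have [A] := lS x I; rewrite !withinET => xA [cA _].
have cqA : compact (q @` A).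
  by apply: continuous_compact => //; exact: continuous_subspaceT.
exists (q @` A); first by move/open_mapP: oq; exact.
by split=> //; exact: compact_closed.
Qed.

Lemma closed_map_embedding S T (f : S -> T) :
  continuous f -> injective f -> closed_map f -> embedding f.
Proof.
move=> cf fI clf; split=> // x A xA.
(* The complement of [A°] has closed image, and injectivity keeps [f x] out of it. *)
exists (~` (f @` (~` A°))).
  apply: open_nbhs_nbhs; split.
    apply: closed_openC; apply: clf; apply: open_closedC.
    exact: open_interior.
  by move=> [y nAy /fI yx]; apply: nAy; rewrite yx.
move=> y /= nAy; apply: contrapT => Ay; apply: nAy; exists y => //.
by move=> /interior_subset.
Qed.

Lemma compact_closed_map S T (f : S -> T) :
  compact [set: S] -> hausdorff_space T -> continuous f -> closed_map f.
Proof.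
move=> cS hT cf C clC; apply: compact_closed => //.
apply: continuous_compact; first exact: continuous_subspaceT.
exact: subclosed_compact cS _.
Qed.

Lemma compact_embedding S T (f : S -> T) :
  compact [set: S] -> hausdorff_space T -> continuous f -> injective f ->
  embedding f.
Proof.
by move=> cS hT cf fI; apply: closed_map_embedding => //;
  exact: compact_closed_map.
Qed.

Lemma embedding_homeomorphism S T (f : S -> T) (g : T -> S) :
  embedding f -> cancel g f -> homeomorphism f.
Proof.
move=> ef gK; split; first exact: embedding_continuous.
exists g; split=> //; last first.
  by move=> x; apply: (embedding_injective ef); rewrite gK.
apply: (embedding_continuousP ef).
by rewrite (_ : f \o g = id); [exact: id_continuousT|apply/funext].
Qed.

Lemma compact_lch T : compact [set: T] -> hausdorff_space T ->
  @second_countable T -> lch_second_countable T.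
Proof.
move=> cT hT sT; split=> // x _; exists setT; last first.
  by split=> //; exact: closedT.
by rewrite withinET; exact: filterT.
Qed.

End Topology.

(** * Faithful closed cocycles *)

Section TopologicalGroup.
Context (G : topologicalGroupType) (U : topologicalType).
Implicit Types f g : U -> G.

Lemma continuous_mulg f g :
  continuous f -> continuous g -> continuous (fun u => f u * g u).
Proof.
by move=> cf cg; exact: continuous_compT (continuous_pair cf cg)
  (@mulg_continuous G).
Qed.

Lemma continuous_invg f : continuous f -> continuous (fun u => (f u)^-1).
Proof. by move=> cf; exact: continuous_compT cf (@invg_continuous G). Qed.

End TopologicalGroup.

Lemma transformation_groupoid_lcg (G : topologicalGroupType)
    (Y : topologicalType) (act : Y -> G -> Y)
    (hact : right_action [set: G] act) :
  lch_second_countable G -> lch_second_countable Y ->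
  continuous (fun p : Y * G => act p.1 p.2) ->
  locally_compact_groupoid (transformation_groupoid hact).
Proof.
move=> lG lY cact.
have cinv : continuous (fun p : Y * G => (act p.1 p.2, p.2^-1)).
  by apply: continuous_pair => //; apply/continuous_invg/snd_continuous.
have invK : involutive (fun p : Y * G => (act p.1 p.2, p.2^-1)).
  by move=> [y g] /=; rewrite invgK (actM hact)// mulgV (act1 hact).
(* The source is the first projection after inversion, so its openness follows once inversion is a
   homeomorphism. *)
have homeo_inv : homeomorphism (fun p : Y * G => (act p.1 p.2, p.2^-1)).
  by split=> //; exists (fun p : Y * G => (act p.1 p.2, p.2^-1)).
split=> //.
- split=> //.
  + exact: fst_continuous.
  + by apply: continuous_pair; [exact: id_continuousT|exact: cst_continuous].
  + have cval := embedding_continuous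
      (embedding_val (composable (transformation_groupoid hact))).
    have cfst := continuous_compT cval (@fst_continuous _ _).
    have csnd := continuous_compT cval (@snd_continuous _ _).
    apply: continuous_pair.
      exact: continuous_compT cfst (@fst_continuous Y G).
    apply: continuous_mulg.
      exact: continuous_compT cfst (@snd_continuous Y G).
    exact: continuous_compT csnd (@snd_continuous Y G).
- exact: lch_prod.
- exact: fst_open_map.
- exact: open_map_comp (homeomorphism_open_map homeo_inv) (@fst_open_map _ _).
Qed.

Section FaithfulClosed.
Context (GG : groupoid) (G : topologicalGroupType) (c : arrow GG -> G).
Context (hc : cocycle c) (GG_lcg : locally_compact_groupoid GG).
Context (G_lch : lch_second_countable G).
Context (c_faithful : faithful_cocycle c) (c_closed : closed_cocycle c).

Local Notation X := (unit_space GG).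
Local Notation Z := (X * G)%type.
Local Notation Y := (mackey_range hc).
Local Notation q := (mackey_class hc : Z -> Y).
Local Notation graph := (range (cocycle_map c)).

Let c_continuous : continuous c := cocycle_continuous hc.
Let rngc : continuous (@rng GG) := rng_continuous (lcg_topological GG_lcg).
Let srcc : continuous (@src GG) := src_continuous (lcg_topological GG_lcg).

Lemma cocycle_map_embedding : embedding (cocycle_map c).
Proof.
apply: closed_map_embedding => //; apply: continuous_pair => //.
exact: continuous_pair.
Qed.

(** An arrow carrying [z] to [z'] must have range [z'.1], value [z'.2 * z.2^-1] and source [z.1].
    Questions about orbits thus become questions about [graph]. *)
Lemma mackey_classP (z z' : Z) :
  q z = q z' <-> graph (z'.1, z'.2 * z.2^-1, z.1).
Proof.
split=> [/quotient_classP[g [/= e <-]]|[g _ [er ec es]]].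
  by exists g => //; rewrite /cocycle_map /= e -mulgA mulgV mulg1.
apply/quotient_classP; exists g, es => /=.
by rewrite er ec -mulgA mulVg mulg1 -surjective_pairing.
Qed.

Lemma mackey_class_surj : range q = [set: Y].
Proof.
apply/seteqP; split=> // y _; exists (quotient_repr y) => //.
exact: quotient_reprK.
Qed.

Lemma mackey_class_continuous : continuous q.
Proof. exact: pi_continuous. Qed.

(* The saturation of [U] is the image under [rng] x [id] of the open set of
   pairs (g, b) with (src g, (c g)^-1 b) in [U]. *)
Lemma mackey_class_open : open_map q.
Proof.
move=> U oU; change (open (q @^-1` (q @` U))).
pose f (p : arrow GG * G) := (src p.1, (c p.1)^-1 * p.2).
have cf : continuous f.
  apply: continuous_pair.
    exact: continuous_compT (@fst_continuous _ _) srcc.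
  apply: continuous_mulg; last exact: snd_continuous.
  apply: continuous_invg; exact: continuous_compT (@fst_continuous _ _) _.
have oW : open (f @^-1` U) by exact: open_preimage.
have := open_map_prod (lcg_rng_open GG_lcg) (@open_map_id G) oW.
congr open; apply/seteqP; split=> [_ [[g b] Ugb <-]|[y b] [[x a] Uxa]] /=.
  exists (f (g, b)) => //; apply/mackey_classP; exists g => //.
  by rewrite /cocycle_map /f /= invgM invgK mulgA mulgV mul1g.
move=> /mackey_classP[g _ [/= er ec es]].
exists (g, b); last by rewrite /= er.
by rewrite /f /= es ec invgM invgK -mulgA mulVg mulg1.
Qed.

(** The relation is the preimage under the continuous [f] of [graph], which is closed as the image
    of the whole arrow space under a closed map. *)
Lemma mackey_relation_closed : closed [set p : Z * Z | q p.1 = q p.2].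
Proof.
have cZ1 := @fst_continuous Z Z; have cZ2 := @snd_continuous Z Z.
have cX := @fst_continuous X G; have cG := @snd_continuous X G.
pose f (p : Z * Z) := (p.2.1, p.2.2 * p.1.2^-1, p.1.1).
have cf : continuous f.
  apply: continuous_pair; last exact: continuous_compT cZ1 cX.
  apply: continuous_pair; first exact: continuous_compT cZ2 cX.
  apply: continuous_mulg; first exact: continuous_compT cZ2 cG.
  by apply: continuous_invg; exact: continuous_compT cZ1 cG.
have := closed_preimage cf (c_closed closedT).
by congr closed; apply/seteqP; split=> [p /mackey_classP|p] //;
  move/mackey_classP.
Qed.

Lemma mackey_range_lch : lch_second_countable Y.
Proof.
apply: open_quotient_lch mackey_class_continuous mackey_class_open
  mackey_class_surj mackey_relation_closed _.
by apply: lch_prod => //; exact: lcg_unit.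
Qed.

(** The product of [q] with the identity of [G] is an open surjection, so continuity is tested on
    [Z * G], where the action is right translation. *)
Lemma mackey_act_continuous :
  continuous (fun p : Y * G => mackey_act p.1 p.2).
Proof.
apply: (open_quotient_continuous
  (open_map_prod mackey_class_open (@open_map_id G))).
  apply/seteqP; split=> // -[y b] _.
  have : range q y by rewrite mackey_class_surj.
  by move=> [z _ <-]; exists (z, b).
rewrite (_ : _ \o _ = q \o (fun p : Z * G => (p.1.1, p.1.2 * p.2))).
  apply: continuous_compT _ mackey_class_continuous.
  have cZ := @fst_continuous Z G.
  apply: continuous_pair.
    exact: continuous_compT cZ (@fst_continuous _ _).
  apply: continuous_mulg; last exact: snd_continuous.
  exact: continuous_compT cZ (@snd_continuous _ _).
by apply/funext => -[[x a] b]; exact: mackey_actE.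
Qed.

Lemma mackey_groupoid_lcg : locally_compact_groupoid (mackey_groupoid hc).
Proof.
apply: transformation_groupoid_lcg => //; first exact: mackey_range_lch.
exact: mackey_act_continuous.
Qed.

(** * The space [Z] as an equivalence *)

(** The moment map is [q] itself. The [Y]-component of an arrow is then forced to be [q z], so only
    its group component moves [z]. *)
Program Definition mackey_right_action :
    right_groupoid_action (mackey_groupoid hc) Z :=
  @RightGroupoidAction (mackey_groupoid hc) Z q
    (fun z h _ => (z.1, z.2 * h.2)) _ _ _.
Next Obligation. by move=> [x a] [y g] /= <-; rewrite mackey_actE. Qed.
Next Obligation. by move=> [x a] /= _; rewrite mulg1. Qed.
Next Obligation. by move=> *; rewrite /= mulgA. Qed.

Let L := mackey_left_action hc.
Let R := mackey_right_action.

Lemma mackey_actions_commute : actions_commute L R.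
Proof.
split=> [g z e|//|g [x a] h /= *]; last by rewrite mulgA.
by apply/esym/quotient_classP; exists g, e.
Qed.

Lemma mackey_lact_continuous : lact_continuous L.
Proof.
split; first exact: fst_continuous.
have cval := embedding_continuous (embedding_val (lact_domain L)).
have cg := continuous_compT cval (@fst_continuous _ _).
have cz := continuous_compT cval (@snd_continuous _ _).
apply: continuous_pair; first exact: continuous_compT cg rngc.
apply: continuous_mulg; first exact: continuous_compT cg c_continuous.
exact: continuous_compT cz (@snd_continuous X G).
Qed.

Lemma mackey_ract_continuous : ract_continuous R.
Proof.
split; first exact: mackey_class_continuous.
have cval := embedding_continuous (embedding_val (ract_domain R)).
have cz := continuous_compT cval (@fst_continuous _ _).
have ch := continuous_compT cval (@snd_continuous _ _).
apply: continuous_pair; first exact: continuous_compT cz (@fst_continuous X G).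
apply: continuous_mulg; first exact: continuous_compT cz (@snd_continuous X G).
exact: continuous_compT ch (@snd_continuous Y G).
Qed.

(** An arrow fixing [(x, a)] has both ends [x] and value [1], hence the same triple as the unit at
    [x]; faithfulness concludes. *)
Lemma mackey_lact_free : lact_free L.
Proof.
move=> g [x a] /= e [er ec]; apply: c_faithful.
rewrite /cocycle_map rng_idn src_idn e er (cocycle1 hc).
by congr (_, _, _); apply: (mulIg a); rewrite ec mul1g.
Qed.

Lemma mackey_ract_free : ract_free R.
Proof.
move=> [x a] [y g] /= e [eg]; rewrite -e; congr pair.
by apply: (mulgI a); rewrite eg mulg1.
Qed.

(** From the pair of [g z] and [z], the map [f] continuously recovers the triple of [g]. After
    embedding the action domain by triples, the preimage of [K] is the [f]-image of the closed part
    of [K] whose triples lie in [graph]. *)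
Lemma mackey_lact_proper : lact_proper L.
Proof.
move=> K cK.
have eD := embedding_comp (embedding_val (lact_domain L))
  (embedding_prod cocycle_map_embedding (embedding_id Z)).
apply: (embedding_compact eD).
have cZ1 := @fst_continuous Z Z; have cZ2 := @snd_continuous Z Z.
have cX := @fst_continuous X G; have cG := @snd_continuous X G.
pose f (p : Z * Z) := ((p.1.1, p.1.2 * p.2.2^-1, p.2.1), p.2).
have cf : continuous f.
  apply: continuous_pair => //.
  apply: continuous_pair; last exact: continuous_compT cZ2 cX.
  apply: continuous_pair; first exact: continuous_compT cZ1 cX.
  apply: continuous_mulg; first exact: continuous_compT cZ1 cG.
  by apply: continuous_invg; exact: continuous_compT cZ2 cG.
rewrite (_ : _ @` _ = f @` (K `&` [set p | graph (f p).1])).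
  apply: continuous_compact; first exact: continuous_subspaceT.
  apply: compact_closedI => //.
  have cf1 := continuous_compT cf (@fst_continuous _ _).
  exact: closed_preimage cf1 (c_closed closedT).
apply/seteqP; split=> [_ [d Kd <-]|_ [[[y b] [x a]] [Kp [g _ [er ec es]]] <-]].
  have e : src (val d).1 = (val d).2.1 := set_mem (valP d).
  have fd : f (lact_map d, (val d).2) = (cocycle_map c (val d).1, (val d).2).
    by rewrite /f /= -mulgA mulgV mulg1 -e.
  exists (lact_map d, (val d).2) => //; split=> //.
  exists (val d).1 => //; exact: (congr1 fst (esym fd)).
have gd : (g, (x, a)) \in lact_domain L by apply/mem_set.
exists (exist (fun p => p \in lact_domain L) _ gd) => /=; last first.
  by rewrite /cocycle_map er ec es.
by rewrite /lact_map /= er ec -mulgA mulVg mulg1.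
Qed.

(** Here [f] recovers the arrow from [z] and [z h], its group component being [z.2^-1] times that of
    [z h]. The pairs of this form are those with equal first coordinates, a closed condition since
    [X] is Hausdorff. *)
Lemma mackey_ract_proper : ract_proper R.
Proof.
move=> K cK.
apply: (embedding_compact (embedding_val (ract_domain R))).
have cZ1 := @fst_continuous Z Z; have cZ2 := @snd_continuous Z Z.
have cX := @fst_continuous X G; have cG := @snd_continuous X G.
pose f (p : Z * Z) := (p.1, (q p.1, p.1.2^-1 * p.2.2)).
have cf : continuous f.
  apply: continuous_pair => //; apply: continuous_pair.
    exact: continuous_compT cZ1 mackey_class_continuous.
  apply: continuous_mulg; last exact: continuous_compT cZ2 cG.
  by apply: continuous_invg; exact: continuous_compT cZ1 cG.
rewrite (_ : _ @` _ = f @` (K `&` [set p | p.1.1 = p.2.1])).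
  apply: continuous_compact; first exact: continuous_subspaceT.
  apply: compact_closedI => //.
  have [_ hX _] := lcg_unit GG_lcg.
  move=> [[x a] [y b]] clp; apply: hX => A B xA yB.
  have := clp ((A `*` setT) `*` (B `*` setT)).
  case=> [|[[z d] [w k]] [/= zw [[/= Az _] [/= Bw _]]]].
    by do 2?apply: nbhs_setX => //=; exact: filterT.
  by exists z; split=> //; rewrite zw.
apply/seteqP; split=> [_ [d Kd <-]|_ [[[x a] [y b]] [Kp /= xy] <-]].
  have e : q (val d).1 = (val d).2.1 := set_mem (valP d).
  exists ((val d).1, ract_map d) => //.
  by rewrite /f /= mulgA mulVg mul1g e -!surjective_pairing.
have zd : f ((x, a), (y, b)) \in ract_domain R by apply/mem_set.
exists (exist (fun p => p \in ract_domain R) _ zd) => //=.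
by rewrite mulgA mulgV mul1g [X in (_, (X, _))]xy.
Qed.

(** The orbits are the fibres of the first projection: the arrow [(q (x, 1), a)] takes [(x, 1)] to
    [(x, a)]. Hence [x] goes back to the orbit of [(x, 1)]. *)
Lemma mackey_rorbit_homeo : exists f : rorbit_space R -> X,
  homeomorphism f /\ forall z, f (rorbit R z) = z.1.
Proof.
pose f (t : rorbit_space R) : X := (quotient_repr t).1.
have fE z : f (rorbit R z) = z.1.
  have /quotient_classP[h [e rz]] := quotient_reprK (rorbit R z).
  exact: (congr1 fst rz).
exists f; split=> //; split.
  apply/quotient_continuous; rewrite (_ : _ \o _ = fst).
    exact: fst_continuous.
  exact/funext.
exists (fun x => rorbit R (x, 1)); split=> [||x].
- apply: (@continuous_compT _ _ _ (fun x => (x, 1)) (rorbit R)).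
    by apply: continuous_pair; [exact: id_continuousT|exact: cst_continuous].
  exact: pi_continuous.
- move=> t; rewrite /f -[RHS]quotient_reprK; apply/quotient_classP.
  case: (quotient_repr t) => x a /=.
  by exists (q (x, 1), a), erefl; rewrite /= mul1g.
- exact: fE.
Qed.

Lemma mackey_equivalence_space : equivalence_space L R.
Proof.
split.
- by apply: lch_prod => //; exact: lcg_unit.
- exact: mackey_lact_continuous.
- exact: mackey_ract_continuous.
- exact: mackey_lact_free.
- exact: mackey_ract_free.
- exact: mackey_lact_proper.
- exact: mackey_ract_proper.
- exact: mackey_actions_commute.
- exact: fst_open_map.
- by apply/seteqP; split=> // x _; exists (x, 1).
- exact: mackey_class_open.
- exact: mackey_class_surj.
- exact: mackey_rorbit_homeo.
(* [Y] is by definition the orbit space of [L], with [q] as orbit map. *)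
- exists id; split=> //; split; first exact: id_continuousT.
  by exists id; split=> //; exact: id_continuousT.
Qed.

Theorem faithful_closed_equivalent :
  groupoid_equivalent GG (mackey_groupoid hc).
Proof.
split=> //; first exact: mackey_groupoid_lcg.
by exists Z, L, R; exact: mackey_equivalence_space.
Qed.

End FaithfulClosed.

(** * Reduction to the classes of the units *)

Section MackeyReduction.
Context (GG : groupoid) (G : topologicalGroupType) (c : arrow GG -> G).
Context (hc : cocycle c) (GG_lcg : locally_compact_groupoid GG).
Context (G_lch : lch_second_countable G).
Context (c_faithful : faithful_cocycle c) (c_closed : closed_cocycle c).
Context (X_compact : compact [set: unit_space GG]).
Context (c_isotropy : forall g, c g = 1 -> rng g = src g).

Local Notation X := (unit_space GG).
Local Notation X' := (mackey_base hc).
Local Notation q := (mackey_class hc).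
Local Notation YG := (mackey_groupoid hc).
Local Notation GG' := (reduction YG X').

Lemma mackey_base_subproof (x : X) : q (x, 1) \in X'.
Proof. by apply/mem_set; exists x. Qed.

Definition mackey_unit (x : X) : X' :=
  exist _ (q (x, 1)) (mackey_base_subproof x).

Lemma mackey_unit_continuous : continuous mackey_unit.
Proof.
apply: (embedding_continuousP (embedding_val X')).
apply: (@continuous_compT _ _ _ (fun x : X => (x, 1 : G)) q).
  by apply: continuous_pair; [exact: id_continuousT|exact: cst_continuous].
exact: mackey_class_continuous.
Qed.

(** Equal classes give an arrow from [x] to [y] of value [1 * 1^-1], whose ends agree by
    [c_isotropy]. *)
Lemma mackey_unit_injective : injective mackey_unit.
Proof.
move=> x y /(congr1 val)/mackey_classP[g _ [/= <- + <-]].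
by rewrite mulgV => /c_isotropy.
Qed.

Lemma mackey_unit_embedding : embedding mackey_unit.
Proof.
apply: compact_embedding => //.
- have [_ hY _] := mackey_range_lch hc GG_lcg G_lch c_closed.
  exact: embedding_hausdorff (embedding_val X') hY.
- exact: mackey_unit_continuous.
- exact: mackey_unit_injective.
Qed.

Lemma mackey_unit_surj (y : X') : {x | mackey_unit x = y}.
Proof.
apply: cid; have [x _ xy] := set_mem (valP y).
by exists x; apply: val_inj.
Qed.

Definition mackey_unit_inv (y : X') : X := projT1 (mackey_unit_surj y).

Lemma mackey_unit_invK : cancel mackey_unit_inv mackey_unit.
Proof. by move=> y; rewrite /mackey_unit_inv; case: mackey_unit_surj. Qed.

Lemma mackey_unitK : cancel mackey_unit mackey_unit_inv.
Proof. by move=> x; apply: mackey_unit_injective; rewrite mackey_unit_invK. Qed.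

Lemma mackey_unit_inv_continuous : continuous mackey_unit_inv.
Proof.
apply: (embedding_continuousP mackey_unit_embedding).
rewrite (_ : _ \o _ = id); first exact: id_continuousT.
exact/funext/mackey_unit_invK.
Qed.

(** The arrow [g] itself carries [(src g, 1)] to [(rng g, c g)]. This places the image of [g] in the
    reduction, with the expected source. *)
Lemma mackey_act_unit (g : arrow GG) :
  mackey_act (q (rng g, 1)) (c g) = q (src g, 1).
Proof.
rewrite mackey_actE mul1g; apply/esym/mackey_classP; exists g => //.
by rewrite /cocycle_map /= invg1 mulg1.
Qed.

Lemma mackey_arrow_subproof (g : arrow GG) :
  (q (rng g, 1), c g) \in reduction_arrows (GG := YG) X'.
Proof.
apply/mem_set; split => /=; first by exists (rng g).
by rewrite mackey_act_unit; exists (src g).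
Qed.

Definition mackey_arrow (g : arrow GG) : arrow GG' :=
  exist _ (q (rng g, 1), c g) (mackey_arrow_subproof g).

Lemma rng_mackey_arrow g : rng (mackey_arrow g) = mackey_unit (rng g).
Proof. exact: val_inj. Qed.

Lemma src_mackey_arrow g : src (mackey_arrow g) = mackey_unit (src g).
Proof. by apply: val_inj; exact: mackey_act_unit. Qed.

Lemma mackey_arrow_surj (h : arrow GG') : {g | cocycle_map c g =
  (mackey_unit_inv (rng h), (val h).2, mackey_unit_inv (src h))}.
Proof.
apply: cid; set x := mackey_unit_inv _; set y := mackey_unit_inv _.
have hx : q (x, 1) = (val h).1 := congr1 val (mackey_unit_invK (rng h)).
have hy : q (y, 1) = mackey_act (val h).1 (val h).2 :=
  congr1 val (mackey_unit_invK (src h)).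
(* The arrow [h] says that [(y, 1)] and [(x, (val h).2)] share an orbit, and the arrow of [GG]
   joining them has the required triple. *)
move: hy; rewrite -hx mackey_actE mul1g => /mackey_classP[g _ ge].
by exists g; rewrite ge /= invg1 mulg1.
Qed.

Definition mackey_arrow_inv (h : arrow GG') : arrow GG :=
  projT1 (mackey_arrow_surj h).

Lemma cocycle_map_mackey_arrow_inv (h : arrow GG') :
  cocycle_map c (mackey_arrow_inv h) =
  (mackey_unit_inv (rng h), (val h).2, mackey_unit_inv (src h)).
Proof. by rewrite /mackey_arrow_inv; case: mackey_arrow_surj. Qed.

Lemma mackey_arrow_continuous : continuous mackey_arrow.
Proof.
apply: (embedding_continuousP (embedding_val (reduction_arrows (GG := YG) X'))).
apply: continuous_pair; last exact: cocycle_continuous hc.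
exact: continuous_compT (continuous_compT (rng_continuous
  (lcg_topological GG_lcg)) mackey_unit_continuous)
  (embedding_continuous (embedding_val X')).
Qed.

(** Since [cocycle_map c] is an embedding, it suffices to check the three coordinates; the last one
    uses continuity of the action on [Y]. *)
Lemma mackey_arrow_inv_continuous : continuous mackey_arrow_inv.
Proof.
have cval := embedding_continuous
  (embedding_val (reduction_arrows (GG := YG) X')).
apply: (embedding_continuousP
  (cocycle_map_embedding hc GG_lcg c_faithful c_closed)).
rewrite (_ : _ \o _ = fun h : arrow GG' =>
  (mackey_unit_inv (rng h), (val h).2, mackey_unit_inv (src h))); last first.
  exact/funext/cocycle_map_mackey_arrow_inv.
apply: continuous_pair; first apply: continuous_pair.
- apply: continuous_compT _ mackey_unit_inv_continuous.
  apply: (embedding_continuousP (embedding_val X')).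
  exact: continuous_compT cval (@fst_continuous _ _).
- exact: continuous_compT cval (@snd_continuous _ _).
- apply: continuous_compT _ mackey_unit_inv_continuous.
  apply: (embedding_continuousP (embedding_val X')).
  exact: continuous_compT cval (mackey_act_continuous GG_lcg).
Qed.

Theorem faithful_closed_reduction : groupoid_isomorphic GG GG'.
Proof.
exists mackey_arrow, mackey_unit; split.
- split; first exact: mackey_arrow_continuous.
  exists mackey_arrow_inv; split=> [|g|h].
  + exact: mackey_arrow_inv_continuous.
  + apply: c_faithful; rewrite cocycle_map_mackey_arrow_inv.
    by rewrite rng_mackey_arrow src_mackey_arrow !mackey_unitK.
  + have [er ec _] := cocycle_map_mackey_arrow_inv h.
    apply: val_inj; rewrite [LHS]/= er ec [RHS]surjective_pairing.
    by congr pair; exact: (congr1 val (mackey_unit_invK (rng h))).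
- exact: embedding_homeomorphism mackey_unit_embedding mackey_unit_invK.
- exact: rng_mackey_arrow.
- exact: src_mackey_arrow.
- move=> g h e e'; apply: val_inj => /=.
  by rewrite rng_comp (cocycleM hc).
Qed.

End MackeyReduction.

(** * Semi-direct products *)

Section SemiDirect.
Context (G : topologicalGroupType) (P : set G) (X : topologicalType).
Context (act : X -> G -> X).
Context (G_lch : lch_second_countable G) (P_ore : ore_subsemigroup P).
Context (P_dense : P `<=` closure P°).
Context (X_compact : compact [set: X]) (X_hausdorff : hausdorff_space X).
Context (X_second_countable : @second_countable X).
Context (hact : right_action P act).
Context (act_continuous :
  {within [set: X] `*` P, continuous (fun p : X * G => act p.1 p.2)}).
Context (hinj : injective_action P act).
Context (act_open : forall U : set (X * G), open U ->
  U `<=` [set: X] `*` P° -> open [set act p.1 p.2 | p in U]).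

Local Notation GG := (semidirect_groupoid P_ore hact hinj).
Local Notation c := (canonical_cocycle P_ore hact hinj).
Local Notation D := (semidirect_arrows P act).
(** The image of [cocycle_map c], written without the subtype of arrows so that limits can be taken
    in the whole product. *)
Local Notation Gamma := [set t : X * G * X | exists a b,
  [/\ P a, P b, t.1.2 = a * b^-1 & act t.1.1 a = act t.2 b]].

Let cX := @fst_continuous X G.
Let cG := @snd_continuous X G.

(** The left translate of [P°] by [a] is open and contained in [P]. *)
Lemma ore_interiorM (a p : G) : P a -> P° p -> P° (a * p).
Proof.
move=> Pa Pp.
have cf : continuous (fun u : G => a^-1 * u).
  by apply: continuous_mulg; [exact: cst_continuous|exact: id_continuousT].
have : nbhs (a * p) ((fun u : G => a^-1 * u) @^-1` P°).
  apply: cf; rewrite mulgA mulVg mul1g; apply: open_nbhs_nbhs.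
  by split; [exact: open_interior|].
apply: filterS => u /= /interior_subset Pu.
by rewrite -[u]mul1g -(mulgV a) -mulgA; exact: (ore_mul P_ore).
Qed.

(** As [1] is in the closure of [P°], there is an interior [p]; expanding a fraction [a * b^-1] by
    [p] makes both terms interior. *)
Lemma ore_interior_denominator (g : G) : exists2 b, P° b & P° (g * b).
Proof.
have [p [Pp _]] := P_dense (ore_one P_ore) filterT.
have [a [b [Pa Pb ->]]] := ore_gen P_ore g.
exists (b * p); first exact: ore_interiorM.
by rewrite mulgA -(mulgA a) mulVg mulg1; exact: ore_interiorM.
Qed.

(** Continuity of the action is only relative to [P], so it yields ordinary continuity along maps
    whose group component stays in [P] near [t]. *)
Lemma act_continuous_at (T : topologicalType) (f : T -> X) (h : T -> G) t :
  {for t, continuous f} -> {for t, continuous h} ->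
  (\forall u \near t, P (h u)) ->
  {for t, continuous (fun u => act (f u) (h u))}.
Proof.
move=> cf ch nP A nA.
have /subspace_continuousP/(_ (f t, h t)) := act_continuous.
move=> /(_ (conj I (nbhs_singleton nP)) A nA) nW.
have cfh : (fun u => (f u, h u)) @ t --> (f t, h t) by exact: cvg_pair.
have nfhW := cfh _ nW.
by move: nfhW nP; apply: (@filterS2 _ (nbhs t)) => u /= + Pu; apply.
Qed.

Lemma act_continuous_l (b : G) : P b -> continuous (act^~ b).
Proof.
move=> Pb x; apply: (@act_continuous_at _ id (fun=> b)).
- exact: id_continuousT.
- exact: cst_continuous.
- exact: nearW.
Qed.

Lemma act_embedding (b : G) : P b -> embedding (act^~ b).
Proof.
move=> Pb; apply: compact_embedding => //; last exact: hinj.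
exact: act_continuous_l.
Qed.

Lemma near_translate (b : G) (p : X * G) : P° (p.2 * b) ->
  \forall p' \near p, P (p'.2 * b).
Proof.
apply: (@continuous_mulg _ _ (fun p : X * G => p.2) (fun=> b)) => //.
exact: cst_continuous.
Qed.

Lemma act_translate_continuous (b : G) (p : X * G) : P° (p.2 * b) ->
  {for p, continuous (fun p : X * G => act p.1 (p.2 * b))}.
Proof.
move=> Pb; apply: (@act_continuous_at _ fst (fun p => p.2 * b)).
- exact: cX.
- by apply: continuous_mulg => //; exact: cst_continuous.
- exact: near_translate.
Qed.

(** Any fraction representing [g] can be traded for [(g * b) * b^-1], whose denominator stays fixed
    while [g] varies. *)
Lemma semidirect_graph_translate x g y b : P b -> P (g * b) ->
  Gamma (x, g, y) -> act x (g * b) = act y b.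
Proof.
move=> Pb Pgb [a' [b' [/= Pa' Pb' ge xy]]].
apply: (semidirect_indep P_ore hact hinj Pa' Pb' Pgb Pb _ xy).
by rewrite -ge -mulgA mulgV mulg1.
Qed.

(* Near g, every g' is the quotient of g' b and b for one fixed b, so that
   the graph is locally the equalizer of two continuous maps. *)
Lemma semidirect_graph_closed : closed Gamma.
Proof.
move=> [[x g] y] cl; have [b Pb Pgb] := ore_interior_denominator g.
have Pb' := interior_subset Pb; have Pgb' := interior_subset Pgb.
exists (g * b), b; split=> //=; first by rewrite -mulgA mulgV mulg1.
apply: X_hausdorff => A B xA yB.
have nA : \forall p \near (x, g), A (act p.1 (p.2 * b)).
  exact: act_translate_continuous.
have nB : \forall y' \near y, B (act y' b) by exact: act_continuous_l.
have nP := near_translate (p := (x, g)) Pgb.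
have [[[x' g'] y'] [ga [[/= Ax' Px'] By']]] :=
  cl _ (nbhs_setX (p := (x, g, y)) (filterI nA nP) nB).
exists (act x' (g' * b)); split=> //.
by rewrite (semidirect_graph_translate _ _ ga).
Qed.

(** For [(x', g')] in [D] near [(x, g)], the point [act x' (g' * b)] lies in the range of [act^~ b],
    which is closed by compactness of [X]; so the limit [act x (g * b)] lies there too. *)
Lemma semidirect_arrows_closed : closed D.
Proof.
move=> [x g] cl; have [b Pb Pgb] := ore_interior_denominator g.
have Pb' := interior_subset Pb; have Pgb' := interior_subset Pgb.
have clXb : closed (range (act^~ b)).
  by apply: compact_closed_map => //; exact: act_continuous_l.
have [|y _ xy] := clXb (act x (g * b)); last first.
  exists (g * b), b, y; split=> //=; first by rewrite -mulgA mulgV mulg1.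
move=> A xA.
have nA : \forall p \near (x, g), A (act p.1 (p.2 * b)).
  exact: act_translate_continuous.
have nP := near_translate (p := (x, g)) Pgb.
have [[x' g'] [[a' [b' [y' ga]]] [/= Ax' Px']]] := cl _ (filterI nA nP).
exists (act x' (g' * b)); split=> //; exists y' => //.
apply/esym/(@semidirect_graph_translate x' g' y') => //.
by exists a', b'.
Qed.

(** * Topology of the semi-direct product groupoid *)

Let val_embedding := embedding_val D.
Let val_continuous := embedding_continuous val_embedding.

Lemma semidirect_arrow_lch : lch_second_countable (arrow GG).
Proof.
apply: lch_closed_embedding val_embedding _ _.
  rewrite (_ : range _ = D); first exact: semidirect_arrows_closed.
  apply/seteqP; split=> [_ [g _ <-]|p Dp]; first exact: set_mem (valP g).
  by exists (exist (fun p => p \in D) p (mem_set Dp)).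
by apply: lch_prod => //; exact: compact_lch.
Qed.

Lemma semidirect_graphE (g : arrow GG) y :
  Gamma (val g, y) <-> src g = y.
Proof.
split=> [[a [b [Pa Pb ga xy]]]|<-].
  exact: semidirect_src_eq Pa Pb ga xy.
have [a [b [y' [Pa Pb e xy]]]] := set_mem (valP g).
by exists a, b; split=> //; exact: semidirect_srcP.
Qed.

(** For [h] near [g], [act (src h) b] depends continuously on [h], and [b] can be cancelled because
    [act^~ b] is an embedding. *)
Lemma semidirect_src_continuous : continuous (@src GG).
Proof.
move=> g A gA.
have [b Pb Pgb] := ore_interior_denominator (val g).2.
have Pb' := interior_subset Pb; have Pgb' := interior_subset Pgb.
have srcE (h : arrow GG) : P ((val h).2 * b) ->
    act (val h).1 ((val h).2 * b) = act (src h) b.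
  move=> Ph; apply: (@semidirect_graph_translate (val h).1 (val h).2) => //.
  by rewrite -surjective_pairing; apply/semidirect_graphE.
have [B gB BA] := embedding_nbhs (act_embedding Pb') gA.
rewrite /= -srcE// in gB.
have nB : \forall h \near g, B (act (val h).1 ((val h).2 * b)).
  exact: val_continuous (act_translate_continuous Pgb gB).
have nP : \forall h \near g, P ((val h).2 * b).
  exact: val_continuous (near_translate Pgb).
apply: filterS2 nB nP => h /= Bh Ph.
by apply: BA; rewrite /= -srcE.
Qed.

Lemma semidirect_rng_continuous : continuous (@rng GG).
Proof. exact: continuous_compT val_continuous cX. Qed.

Lemma semidirect_inv_continuous : continuous (@Defs.inv GG).
Proof.
apply: (embedding_continuousP val_embedding).
apply: continuous_pair; first exact: semidirect_src_continuous.
by apply: continuous_invg; exact: continuous_compT val_continuous cG.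
Qed.

(* If x0 a0 = y0 b0, then x a0 lies in the open set X V for x close to x0 and
   V a small neighbourhood of b0, so that x is the range of some (x, a0 b^-1)
   close to (x0, a0 b0^-1). *)
Lemma semidirect_rng_open : open_map (@rng GG).
Proof.
apply/open_mapP => g0 U /(embedding_nbhs val_embedding)[W g0W WU].
case: g0W => -[A B] /= [x0A g0B] ABW.
have [b0 Pb0 Pa0] := ore_interior_denominator (val g0).2.
set a0 := (val g0).2 * b0 in Pa0.
have Pb0' := interior_subset Pb0; have Pa0' := interior_subset Pa0.
have g0E : (val g0).2 = a0 * b0^-1 by rewrite /a0 -mulgA mulgV mulg1.
pose V := [set b | B (a0 * b^-1)] `&` P.
have b0V : V° b0.
  apply: filterI => //.
  have ch : continuous (fun b : G => a0 * b^-1).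
    apply: continuous_mulg; first exact: cst_continuous.
    by apply: continuous_invg; exact: id_continuousT.
  by apply: ch; rewrite -g0E.
have oXV : open [set act p.1 p.2 | p in [set: X] `*` V°].
  apply: act_open.
    rewrite openE => -[x b] [_ /= Vb].
    by apply: nbhs_setX; [exact: filterT|exact: nbhs_interior].
  by move=> [x b] [_ /= Vb]; split=> //; apply: filterS Vb => u [].
have x0XV : [set act p.1 p.2 | p in [set: X] `*` V°] (act (val g0).1 a0).
  exists (src g0, b0) => //=; apply/esym.
  exact: (@semidirect_srcP _ _ _ _ P_ore hact hinj).
have nx : \forall x \near (val g0).1,
    [set act p.1 p.2 | p in [set: X] `*` V°] (act x a0).
  exact: act_continuous_l (open_nbhs_nbhs (conj oXV x0XV)).
apply: filterS2 x0A nx => x Ax [[y b] [_ /= /interior_subset[Bb Pb]] yx].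
have Dx : (x, a0 * b^-1) \in D by apply/mem_set; exists a0, b, y.
exists (exist (fun p => p \in D) _ Dx) => //.
by apply: WU; exact: ABW.
Qed.

Lemma semidirect_invK : involutive (@Defs.inv GG).
Proof.
move=> g; apply: val_inj; rewrite /= [RHS]surjective_pairing invgK.
by congr pair; exact: (src_inv (g : arrow GG)).
Qed.

Lemma semidirect_lcg : locally_compact_groupoid GG.
Proof.
split.
- split.
  + exact: semidirect_rng_continuous.
  + exact: semidirect_src_continuous.
  + apply: (embedding_continuousP val_embedding).
    by apply: continuous_pair; [exact: id_continuousT|exact: cst_continuous].
  + exact: semidirect_inv_continuous.
  + apply: (embedding_continuousP val_embedding).
    have cval := embedding_continuous (embedding_val (composable GG)).
    have cg := continuous_compT (continuous_compT cval (@fst_continuous _ _))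
      val_continuous.
    have ch := continuous_compT (continuous_compT cval (@snd_continuous _ _))
      val_continuous.
    apply: continuous_pair; first exact: continuous_compT cg cX.
    apply: continuous_mulg; first exact: continuous_compT cg cG.
    exact: continuous_compT ch cG.
- exact: semidirect_arrow_lch.
- exact: compact_lch.
- exact: semidirect_rng_open.
- rewrite (_ : @src GG = @rng GG \o @Defs.inv GG); last first.
    by apply/funext => g; apply/esym; exact: (@rng_inv GG g).
  apply: open_map_comp _ semidirect_rng_open.
  apply: homeomorphism_open_map; split; first exact: semidirect_inv_continuous.
  exists (@Defs.inv GG); split; [exact: semidirect_inv_continuous|
    exact: semidirect_invK|exact: semidirect_invK].
Qed.

(** * The canonical cocycle *)

Lemma canonical_cocycle_faithful : faithful_cocycle c.
Proof.
move=> g h [er ec _]; apply: val_inj.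
by rewrite [LHS]surjective_pairing [RHS]surjective_pairing; congr pair.
Qed.

(** A closed set of arrows is the trace of a closed [W] in [X * G], and its image is the part of the
    closed set [Gamma] lying over [W]. *)
Lemma canonical_cocycle_closed : closed_cocycle c.
Proof.
move=> C clC.
have [W clW CW] : exists2 W : set (X * G), closed W & C = val @^-1` W.
  have [W oW CW] := closed_openC clC; exists (~` W); first exact: open_closedC.
  by rewrite -[LHS]setCK -CW.
rewrite (_ : _ @` _ = Gamma `&` fst @^-1` W).
  apply: closedI; first exact: semidirect_graph_closed.
  exact: closed_preimage (@fst_continuous _ _) clW.
apply/seteqP; split=> [_ [g Cg <-]|[[x g] y] [ga /= Wxg]].
  rewrite /cocycle_map -surjective_pairing; split; last by rewrite CW in Cg.
  exact/semidirect_graphE.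
have Dg : (x, g) \in D by apply/mem_set; move: ga => [a [b xy]]; exists a, b, y.
exists (exist (fun p => p \in D) _ Dg); first by rewrite CW.
by rewrite /cocycle_map; congr pair; apply/semidirect_graphE.
Qed.

Lemma canonical_cocycle_isotropy g : c g = 1 -> rng g = src g.
Proof.
move=> cg; apply/esym/semidirect_graphE; have P1 := ore_one P_ore.
(* The fraction [1 * 1^-1] exhibits [rng g] as the source of [g]. *)
by exists 1, 1; split; rewrite //= mulgV.
Qed.

End SemiDirect.

Theorem mainTheorem5 (G : topologicalGroupType) (P : set G)
    (X : topologicalType) (act : X -> G -> X)
    (G_lch : lch_second_countable G)
    (P_closed : closed P)
    (P_ore : ore_subsemigroup P)
    (P_dense : P `<=` closure P°)
    (X_compact : compact [set: X])
    (X_hausdorff : hausdorff_space X)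
    (X_second_countable : @second_countable X)
    (act_action : right_action P act)
    (act_continuous : {within [set: X] `*` P,
                         continuous (fun p : X * G => act p.1 p.2)})
    (act_inj : injective_action P act)
    (act_open : forall U : set (X * G), open U -> U `<=` [set: X] `*` P° ->
                  open [set act p.1 p.2 | p in U]) :
  let GG := semidirect_groupoid P_ore act_action act_inj in
  let c : arrow GG -> G := canonical_cocycle P_ore act_action act_inj in
  let hc : cocycle c := canonical_cocycleP P_ore act_action act_inj in
  [/\ faithful_cocycle c /\ closed_cocycle c,
      groupoid_equivalent GG (mackey_groupoid hc) &
      groupoid_isomorphic GG
        (reduction (mackey_groupoid hc) (mackey_base hc))].
Proof.
move=> GG c hc.
have GG_lcg : locally_compact_groupoid GG by exact: semidirect_lcg.
have cf : faithful_cocycle c by exact: canonical_cocycle_faithful.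
have cc : closed_cocycle c by exact: canonical_cocycle_closed.
split=> //; first exact: faithful_closed_equivalent.
apply: faithful_closed_reduction => //.
exact: canonical_cocycle_isotropy.
Qed.
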